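(* Let $p>2$ be a prime such that $\mathrm{Cl}(p^2+4)$ is trivial, and let $\omega_1,\omega_2,\omega_3\in\mathbb{Z}_{\ge2}\cup\{\infty\}$ with (at least) one $\omega_i$ finite. If $m=(2+p^2)^2\pm p^{\alpha}k^2$ for some integers $\alpha\ge0$, $k>0$ with $p\nmid k$ (and $m\notin\{0,4\}$), then $(\mathcal{X}_m,\mathcal{D}_{\underline\omega})^*_{\mathrm{str}}(\mathbb{Z})\ne\emptyset$ (for both Campana and Darmon points).
   Context: For $D\in\mathbb{Z}$, $D\equiv0,1\bmod4$, $\mathrm{Cl}(D)$ denotes the class group of (primitive) integral binary quadratic forms of discriminant $D$ up to $\mathrm{GL}_2(\mathbb{Z})$-equivalence; ''trivial'' means it has one element. For $m\in\mathbb{Z}\setminus\{0,4\}$: $U_m\subset\mathbb{A}^3_{\mathbb{Q}}$ is $u_1^2+u_2^2+u_3^2-u_1u_2u_3=m$; $\mathcal{X}_m\subset\mathbb{P}^3_{\mathbb{Z}}$ is $x_0(x_1^2+x_2^2+x_3^2)-x_1x_2x_3=mx_0^3$ with generic fibre $X_m$, $U_m=X_m\cap\{x_0\ne0\}$ via $u_l=x_l/x_0$. $D_l=\{x_0=x_l=0\}$, $\mathcal{D}_l$ its closure in $\mathcal{X}_m$, $\mathcal{D}_{\underline\omega}=\sum(1-1/\omega_l)\mathcal{D}_l$, $\mathcal{D}_{\inf}=\bigcup_{\omega_l=\infty}\mathcal{D}_l$. For a prime $q$ and $M_q\in\mathcal{X}_m(\mathbb{Z}_q)$, write $\mathrm{Spec}\,\mathbb{Z}_q\times_{\mathcal{X}_m}\mathcal{D}_l=\mathrm{Spec}(\mathbb{Z}_q/I)$,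 $n_q(\mathcal{D}_l,M_q)=\infty$ if $I=0$, $=n$ if $I=(q^n)$. $(\mathcal{X}_m,\mathcal{D}_{\underline\omega})^*_{\mathrm{str}}(\mathbb{Z})$ is the set of $M\in U_m(\mathbb{Q})$ such that for every prime $q$, $M\in(\mathcal{X}_m\setminus\mathcal{D}_{\inf})(\mathbb{Z}_q)$ and for every $l$ with $\omega_l<\infty$, $n_q(\mathcal{D}_l,M)\in\mathbb{Z}_{\ge\omega_l}\cup\{0,\infty\}$ (Campana) resp. $\in\omega_l\mathbb{Z}_{\ge0}\cup\{\infty\}$ (Darmon). *)

(* Defs.v *)
From HB Require Import structures.
From mathcomp Require Import all_boot all_order all_algebra.
From mathcomp Require Import boolp classical_sets.

Set Implicit Arguments.
Unset Strict Implicit.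
Unset Printing Implicit Defensive.

Import GRing.Theory.
Local Open Scope ring_scope.
Local Open Scope classical_set_scope.

(** * The ring Z_q of q-adic integers *)

(* The inverse limit of the rings Z/q^n, each class being represented by its
   least non-negative residue: the single condition [padic_coh] says both that
   [padic_res n] is reduced modulo q^n and that the family is coherent.  For
   the junk moduli q = 0 and q = 1 one gets Z and the zero ring. *)
Record padic (q : nat) := Padic {
  padic_res : nat -> int;
  padic_coh : forall n,
    padic_res n = (padic_res n.+1 %% (q ^ n)%N%:Z)%Z }.

Section PadicRing.
Variable q : nat.
Implicit Types x y z : padic q.

Local Notation qz n := ((q ^ n)%N%:Z).

Lemma padic_eqP x y : (forall n, padic_res x n = padic_res y n) -> x = y.
Proof.
case: x y => [f Hf] [g Hg] /= fg.
have E : f = g by apply/funext.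
by subst g; rewrite (Prop_irrelevance Hf Hg).
Qed.

Lemma modz_dvd_mod (m d e : int) : (d %| e)%Z -> ((m %% e)%Z = m %[mod d])%Z.
Proof.
by move=> /dvdzP [c ->]; rewrite {2}(divz_eq m (c * d)) mulrA modzMDl.
Qed.

Lemma padic_modS (a : int) n : ((a %% qz n.+1)%Z = a %[mod qz n])%Z.
Proof. by apply: modz_dvd_mod; rewrite expnS PoszM dvdz_mull. Qed.

Lemma padic_redP x n : (padic_res x n %% qz n)%Z = padic_res x n.
Proof. by rewrite padic_coh modz_mod. Qed.

Lemma padic_cohm x n : (padic_res x n.+1 = padic_res x n %[mod qz n])%Z.
Proof. by rewrite (padic_coh x n) modz_mod. Qed.

Fact padic_reduce_coh (f : nat -> int)
    (Hf : forall n, (f n.+1 = f n %[mod qz n])%Z) (n : nat) :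
  (f n %% qz n)%Z = ((f n.+1 %% qz n.+1)%Z %% qz n)%Z.
Proof. by rewrite padic_modS Hf. Qed.

Definition padic_of f Hf : padic q :=
  @Padic q (fun n => (f n %% qz n)%Z) (@padic_reduce_coh f Hf).

Fact padic_const_coh (a : int) n : (a = a %[mod qz n])%Z.
Proof. by []. Qed.

Fact padic_add_coh x y n :
  (padic_res x n.+1 + padic_res y n.+1 =
   padic_res x n + padic_res y n %[mod qz n])%Z.
Proof. by rewrite -modzDm !padic_cohm modzDm. Qed.

Fact padic_opp_coh x n : (- padic_res x n.+1 = - padic_res x n %[mod qz n])%Z.
Proof. by rewrite -modzNm padic_cohm modzNm. Qed.

Fact padic_mul_coh x y n :
  (padic_res x n.+1 * padic_res y n.+1 =
   padic_res x n * padic_res y n %[mod qz n])%Z.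
Proof. by rewrite -modzMm !padic_cohm modzMm. Qed.

Definition padic_const (a : int) := padic_of (padic_const_coh a).
Definition padic_add x y := padic_of (padic_add_coh x y).
Definition padic_opp x := padic_of (padic_opp_coh x).
Definition padic_mul x y := padic_of (padic_mul_coh x y).

Fact padic_addA : associative padic_add.
Proof. by move=> x y z; apply: padic_eqP => n /=; rewrite modzDmr modzDml addrA. Qed.

Fact padic_addC : commutative padic_add.
Proof. by move=> x y; apply: padic_eqP => n /=; rewrite addrC. Qed.

Fact padic_add0 : left_id (padic_const 0) padic_add.
Proof. by move=> x; apply: padic_eqP => n /=; rewrite modzDml add0r padic_redP. Qed.

Fact padic_addN : left_inverse (padic_const 0) padic_opp padic_add.
Proof. by move=> x; apply: padic_eqP => n /=; rewrite modzDml addNr. Qed.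

Fact padic_mulA : associative padic_mul.
Proof. by move=> x y z; apply: padic_eqP => n /=; rewrite modzMmr modzMml mulrA. Qed.

Fact padic_mulC : commutative padic_mul.
Proof. by move=> x y; apply: padic_eqP => n /=; rewrite mulrC. Qed.

Fact padic_mul1 : left_id (padic_const 1) padic_mul.
Proof. by move=> x; apply: padic_eqP => n /=; rewrite modzMml mul1r padic_redP. Qed.

Fact padic_mulDl : left_distributive padic_mul padic_add.
Proof. by move=> x y z; apply: padic_eqP => n /=; rewrite modzMml modzDm mulrDl. Qed.

HB.instance Definition _ := gen_eqMixin (padic q).
HB.instance Definition _ := gen_choiceMixin (padic q).
HB.instance Definition _ :=
  GRing.isZmodule.Build (padic q) padic_addA padic_addC padic_add0 padic_addN.
HB.instance Definition _ :=
  GRing.Zmodule_isComPzRing.Build (padic q)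
    padic_mulA padic_mulC padic_mul1 padic_mulDl.

End PadicRing.

(** * Classes of binary quadratic forms *)

(* The form a x^2 + b x y + c y^2. *)
Record bqf := Bqf { qa : int; qb : int; qc : int }.

Definition bqf_eval (f : bqf) (v : 'cV[int]_2) : int :=
  let x := v ord0 ord0 in let y := v ord_max ord0 in
  qa f * x ^+ 2 + qb f * x * y + qc f * y ^+ 2.

Definition bqf_disc (f : bqf) : int := qb f ^+ 2 - 4 * qa f * qc f.

Definition bqf_primitive (f : bqf) : Prop :=
  gcdz (gcdz (qa f) (qb f)) (qc f) = 1.

(* Over Z, [unitmx] is GL_2(Z) (determinant 1 or -1), and an integral form is
   determined by its values. *)
Definition bqf_equiv (f g : bqf) : Prop :=
  exists2 A : 'M[int]_2, A \in unitmx &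
    forall v : 'cV[int]_2, bqf_eval g v = bqf_eval f (A *m v).

Definition prim_forms (D : int) : set bqf :=
  [set f | bqf_primitive f /\ bqf_disc f = D].

(* Underlying set of the class group: its elements are equivalence classes. *)
Definition Cl (D : int) : set (set bqf) :=
  [set [set g | prim_forms D g /\ bqf_equiv f g] | f in prim_forms D].

Definition Cl_trivial (D : int) : Prop := exists c, Cl D = [set c].

(** * The Markoff-type surfaces *)

(* U_m(Q), in the coordinates u_1, u_2, u_3. *)
Definition U_points (m : int) : set ('I_3 -> rat) :=
  [set u | \sum_l u l ^+ 2 - \prod_l u l = m%:~R].

(* Homogeneous coordinates: x_0 is [x ord0], and x_1, x_2, x_3 are
   [xc x l] for [l : 'I_3]. *)
Definition xc (A : Type) (x : 'I_4 -> A) (l : 'I_3) : A := x (lift ord0 l).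

(* Homogeneous coordinates of the A-points of the projective surface X_m, for A
   a local ring: an A-point of P^3 is then given by coordinates generating the
   unit ideal, uniquely up to a common unit factor.  All the notions below are
   insensitive to that factor. *)
Definition X_points (m : int) (A : comPzRingType) : set ('I_4 -> A) :=
  [set x | (exists a : 'I_4 -> A, \sum_i a i * x i = 1) /\
           x ord0 * (\sum_l xc x l ^+ 2) - \prod_l xc x l
             = m%:~R * x ord0 ^+ 3].

(* The point [x_0 : x_1 : x_2 : x_3] over Z_q has generic fibre the rational
   point (u_1, u_2, u_3), i.e. x_l = u_l x_0 in Q_q.  As Z_q has no torsion this
   may be written without denominators. *)
Definition extends_to (q : nat) (u : 'I_3 -> rat) (x : 'I_4 -> padic q) : Prop :=
  forall l, (denq (u l))%:~R * xc x l = (numq (u l))%:~R * x ord0.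

(* The ideal I with Spec A x_{X_m} D_l = Spec (A/I).  The closure in X_m of
   the line x_0 = x_l = 0 of the generic fibre is the subscheme cut out by the
   same equations, since the latter is a copy of P^1 over Z, hence integral and
   flat over Z. *)
Definition ideal_D (A : comPzRingType) (x : 'I_4 -> A) (l : 'I_3) : set A :=
  [set z | exists a b : A, z = a * x ord0 + b * xc x l].

Definition principal (A : comPzRingType) (c : A) : set A :=
  [set z | exists a : A, z = a * c].

(* N together with infinity, which is [None]. *)
Definition natbar := option nat.

(* [is_mult x l n] says that n_q(D_l, x) = n. *)
Definition is_mult (q : nat) (x : 'I_4 -> padic q) (l : 'I_3) (n : natbar) :
    Prop :=
  match n with
  | None => ideal_D x l = [set 0]
  | Some n => ideal_D x l = principal (q%:R ^+ n)
  end.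

(* A Z_q-point avoids the closed subscheme D_l iff the fibre product of the two
   is empty, i.e. iff I is the unit ideal. *)
Definition avoids_Dinf (q : nat) (w : 'I_3 -> natbar) (x : 'I_4 -> padic q) :
    Prop :=
  forall l, w l = None -> ideal_D x l = setT.

Definition campana_mult (w : nat) (n : natbar) : Prop :=
  match n with None => True | Some n => (w <= n)%N \/ n = 0%N end.

Definition darmon_mult (w : nat) (n : natbar) : Prop :=
  match n with None => True | Some n => exists j : nat, n = (w * j)%N end.

Definition orbifold_str_points (allowed : nat -> natbar -> Prop)
    (m : int) (w : 'I_3 -> natbar) : set ('I_3 -> rat) :=
  [set u | U_points m u /\
    forall q : nat, prime q -> exists x : 'I_4 -> padic q,
      [/\ @X_points m (padic q) x, extends_to u x, avoids_Dinf w x &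
          forall (l : 'I_3) (wl : nat), w l = Some wl ->
            exists2 n : natbar, is_mult x l n & allowed wl n]].

Definition campana_str_points := orbifold_str_points campana_mult.

Definition darmon_str_points := orbifold_str_points darmon_mult.

(* Main.v *)
(** Intersecting the surface with u_i = 2 + p^2, where the i-th weight is finite,
    leaves the conic x^2 - (2 + p^2) x y + y^2 = +- p^alpha k^2.  Under
    x = y + p z its left-hand side is p^2 (z^2 - p z y - y^2), and
    z^2 - p z y - y^2 is the norm of z - y t for t^2 = p t + 1.  Here t has norm
    -1 and 1 + t has norm p, so k t^s (1 + t)^n takes every value +- p^n k^2.
    Modulo p, Z[t] becomes F_p x F_p through t = 1 and t = -1, where 1 + t is
    (2, 0): hence p never divides the resulting y.  Dividing by p^N therefore
    gives a rational point with exact denominator p^N in the two coordinates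
    other than u_i, whose only nonzero multiplicity is n_p(D_i) = N; take
    N = w_i. *)
Require Import Defs.
From mathcomp Require Import all_boot all_order all_algebra.
From mathcomp Require Import boolp classical_sets.
From mathcomp Require Import ring zify.

Set Implicit Arguments.
Unset Strict Implicit.
Unset Printing Implicit Defensive.

Import GRing.Theory.
Local Open Scope ring_scope.

Lemma padic_res_int (q : nat) (a : int) n :
  padic_res (a%:~R : padic q) n = (a %% (q ^ n)%N%:Z)%Z.
Proof.
have res_nat (j : nat) :
    padic_res (j%:R : padic q) n = (j%:Z %% (q ^ n)%N%:Z)%Z.
  elim: j => [|j IHj]; first by rewrite mulr0n.
  by rewrite mulrSr /= IHj modzDm -addn1 PoszD.
case: a => j; first exact: res_nat.
by rewrite NegzE mulrNz /= -/(j.+1%:R) res_nat modzNm.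
Qed.

(** Inverses of [d] modulo the powers of [q] come from Bezout; they are coherent because [d] can be
    cancelled modulo [q ^ n]. *)
Lemma padic_unit_coprime (q : nat) (d : int) :
  coprimez d q%:Z -> exists z : padic q, z * d%:~R = 1.
Proof.
move=> d_q.
have dX n : coprimez d (q ^ n)%N%:Z.
  by rewrite -natz natrX natz coprimezXr.
pose f n := (egcdz d (q ^ n)%N%:Z).1.
have fP n : (f n * d = 1 %[mod (q ^ n)%N%:Z])%Z.
  rewrite /f; case: egcdzP => u v uv _ /=.
  by move: uv; rewrite (eqP (dX n)) => <-; rewrite addrC modzMDl.
have f_coh n : (f n.+1 = f n %[mod (q ^ n)%N%:Z])%Z.
  apply/eqP; rewrite eqz_mod_dvd -(@Gauss_dvdzl _ _ d); last first.
    by rewrite coprimez_sym.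
  rewrite mulrBl -eqz_mod_dvd fP; apply/eqP.
  rewrite -[LHS](@modz_dvd_mod _ _ (q ^ n.+1)%N%:Z) ?fP ?modz_dvd_mod //;
    by rewrite expnS PoszM dvdz_mull.
exists (padic_of f_coh); apply: padic_eqP => n.
by rewrite /= padic_res_int modzMm fP.
Qed.

Lemma ideal_D_setT (A : comPzRingType) (x : 'I_4 -> A) l a b :
  a * x ord0 + b * xc x l = 1 -> ideal_D x l = setT.
Proof.
move=> ab1; apply/seteqP; split=> // z _.
by exists (z * a), (z * b); rewrite -!mulrA -mulrDr ab1 mulr1.
Qed.

Lemma principal1 (A : comPzRingType) : principal (1 : A) = setT.
Proof. by apply/seteqP; split=> // z _; exists z; rewrite mulr1. Qed.

(** The homogeneous coordinates [p ^ N], [b l] serve for all primes [q] at once. For [l != i] the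
    ideal of [D_l] is the unit ideal, while that of [D_i] is generated by [p ^ N]. Only the
    multiplicities 0 and [N] occur, so Campana and Darmon points are treated together. *)
Lemma orbifold_str_points_int (allowed : nat -> natbar -> Prop) (m : int)
    (w : 'I_3 -> natbar) (p N : nat) (i : 'I_3) (b : 'I_3 -> int) :
    (forall n, allowed n (Some 0%N)) -> allowed N (Some N) ->
    prime p -> w i = Some N ->
    ((p%:Z ^+ N) %| b i)%Z ->
    (forall l, l != i -> coprimez p%:Z (b l)) ->
    p%:Z ^+ N * (\sum_l b l ^+ 2) - \prod_l b l = m * (p%:Z ^+ N) ^+ 3 ->
  orbifold_str_points allowed m w (fun l => (b l)%:~R / (p%:Z ^+ N)%:~R).
Proof.
set d := p%:Z ^+ N; have dE : d = p%:Z ^+ N by []; clearbody d.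
move=> allowed0 allowedN p_prime wi /dvdzP[c bi] b_p eq_b.
have p_neq0 : p%:Z != 0 by rewrite eqz_nat -lt0n prime_gt0.
have d_neq0 : d%:~R != 0 :> rat by rewrite intr_eq0 dE expf_neq0.
split.
  have d3_neq0 : (d%:~R ^+ 3 : rat) != 0 by rewrite expf_neq0.
  apply: (mulIf d3_neq0) => /=.
  rewrite -!rmorphXn -rmorphM -eq_b !big_ord_recl !big_ord0 /=.
  rewrite rmorphB !(rmorphM, rmorphD, rmorphXn, rmorph0, rmorph1) /=.
  by field.
move=> q q_prime.
pose x (j : 'I_4) : padic q := (oapp b d (unlift ord0 j))%:~R.
have x0 : x ord0 = d%:~R by rewrite /x unlift_none.
have xl l : xc x l = (b l)%:~R by rewrite /xc /x liftK.
have bezout l : l != i -> exists a e : padic q, a * x ord0 + e * xc x l = 1.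
  move=> li; have cop : coprimez d (b l) by rewrite dE coprimezXl ?b_p.
  have [u [v uv]] := Bezoutz d (b l).
  exists u%:~R, v%:~R; rewrite x0 xl -!rmorphM -rmorphD /= uv.
  by rewrite (eqP cop).
exists x; split.
- split.
    have [l li] : exists l : 'I_3, l != i.
      by case: (eqVneq i ord0) => [->|]; [exists ord_max | exists ord0; rewrite eq_sym].
    have [a [e ae]] := bezout l li.
    exists (fun j => if j == ord0 then a else if j == lift ord0 l then e else 0).
    rewrite (bigD1 ord0) //= (bigD1 (lift ord0 l)) //= eqxx big1 ?addr0 //.
    by move=> j /andP[/negPf-> /negPf->]; rewrite mul0r.
  have -> : \sum_l xc x l ^+ 2 = (\sum_l b l ^+ 2)%:~R.
    by rewrite rmorph_sum; apply: eq_bigr => l _; rewrite xl rmorphXn.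
  have -> : \prod_l xc x l = (\prod_l b l)%:~R.
    by rewrite rmorph_prod; apply: eq_bigr => l _; rewrite xl.
  by rewrite x0 -rmorphXn -!rmorphM -rmorphB eq_b.
(* Both sides are images of integers, so the equality is checked in the rationals. *)
- move=> l; rewrite x0 xl -!rmorphM /=; congr (_%:~R).
  set u : rat := _ / _; apply/eqP; rewrite -(eqr_int rat) !rmorphM /= numqE.
  by apply/eqP; rewrite mulrAC mulrC /u divfK.
- move=> l wl; have li : l != i.
    by apply: contra_eq_neq wl => ->; rewrite wi.
  by have [a [e /ideal_D_setT]] := bezout l li.
move=> l wl wlE; have [li|li] := eqVneq l i; last first.
  have [a [e /ideal_D_setT E]] := bezout l li.
  by exists (Some 0%N); rewrite /= ?E ?expr0 ?principal1.
move: wlE; rewrite li wi => -[<-].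
have bi_ideal : ideal_D x i = principal (d%:~R : padic q).
  apply/seteqP; split=> z /=; rewrite /ideal_D /= x0 xl bi rmorphM.
    by case=> [a [e ->]]; exists (a + e * c%:~R); rewrite mulrDl mulrA.
  by case=> [a ->]; exists a, 0; rewrite mul0r addr0.
have [qp|qp] := eqVneq q p.
  exists (Some N) => //=.
  by rewrite bi_ideal dE rmorphXn /= -pmulrn qp.
exists (Some 0%N); rewrite //= expr0 principal1.
(* For [q != p], [p ^ N] is a unit of the [q]-adic integers. *)
have [|z zd] := @padic_unit_coprime q d.
  by rewrite dE coprimezXl // coprimezE /= prime_coprime // dvdn_prime2 // eq_sym.
by apply: (@ideal_D_setT _ _ _ z 0); rewrite mul0r addr0 x0.
Qed.

(** The pair [(z, y)] stands for the element z - y t, here (1 + t)^(n+1); the zeroth power is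
    excluded since it has y = 0. The divisibility of [z + y], the value at t = -1, is what carries
    the induction: it makes the next [y] congruent to 2 y modulo the odd prime [p]. *)
Lemma norm_form_pow (p : nat) n : prime p -> (2 < p)%N ->
  exists z y : int, [/\ z ^+ 2 - p%:Z * z * y - y ^+ 2 = p%:Z ^+ n.+1,
    (p%:Z %| z + y)%Z & ~~ (p%:Z %| y)%Z].
Proof.
move=> p_prime p_gt2; elim: n => [|n [z [y [zyE dzy ndy]]]].
  exists 1, (-1); split; [by ring | by rewrite subrr | ].
  by rewrite dvdzE /= dvdn1; case: p p_gt2 {p_prime} => [|[|[|]]].
(* Multiplication of z - y t by 1 + t. *)
exists (z - y), ((1 + p%:Z) * y - z); split.
- by rewrite [RHS]exprS -zyE; ring.
- have -> : z - y + ((1 + p%:Z) * y - z) = y * p%:Z by ring.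
  exact: dvdz_mull.
have -> : (1 + p%:Z) * y - z = 2 * y + (y * p%:Z - (z + y)) by ring.
rewrite rpredDr; last by rewrite rpredB ?dvdz_mull.
by rewrite dvdzE abszM Euclid_dvdM // negb_or gtnNdvd.
Qed.

Lemma norm_form_signed_pow (p : nat) (s : bool) n : prime p -> (2 < p)%N ->
  exists z y : int, z ^+ 2 - p%:Z * z * y - y ^+ 2 = (-1) ^+ s * p%:Z ^+ n.+1 /\
    ~~ (p%:Z %| y)%Z.
Proof.
move=> p_prime p_gt2.
have [z [y [zyE dzy ndy]]] := norm_form_pow n p_prime p_gt2.
case: s; last by exists z, y; rewrite mul1r.
(* Multiplication of z - y t by t. *)
exists (- y), (p%:Z * y - z); split; first by rewrite -zyE; ring.
have -> : p%:Z * y - z = y + (y * p%:Z - (z + y)) by ring.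
by rewrite rpredDr // rpredB ?dvdz_mull.
Qed.

Lemma orbifold_str_points_neq0 (allowed : nat -> natbar -> Prop)
    (p : nat) (w : 'I_3 -> natbar) (m : int) (alpha k : nat) (s : bool)
    (i : 'I_3) (N : nat) :
    (forall n, allowed n (Some 0%N)) -> allowed N (Some N) ->
    prime p -> (2 < p)%N -> w i = Some N -> (2 <= N)%N -> ~~ (p %| k)%N ->
    m = (2 + p%:Z ^+ 2) ^+ 2 + (-1) ^+ s * (p%:Z ^+ alpha * k%:Z ^+ 2) ->
  (orbifold_str_points allowed m w !=set0)%classic.
Proof.
move=> allowed0 allowedN p_prime p_gt2 wi N_ge2 ndk mE.
(* The norm must be [p ^ (alpha + 2 N - 2)] up to sign: clearing the denominators [p ^ N]
   contributes 2 N to the exponent, and x = y + p z already supplies [p ^ 2]. As [2 <= N], the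
   truncated subtraction is exact. *)
have [z [y [zyE ndy]]] :=
  norm_form_signed_pow s (alpha + (N.*2 - 3)) p_prime p_gt2.
pose d := p%:Z ^+ N.
pose b l := if l == i then (2 + p%:Z ^+ 2) * d
            else if l == ordS i then k%:Z * y else k%:Z * (y + z * p%:Z).
exists (fun l => (b l)%:~R / d%:~R).
apply: (@orbifold_str_points_int allowed m w p N i b) => //.
- by rewrite /b eqxx dvdz_mull.
- move=> l /negPf li; rewrite /b li coprimezE prime_coprime //.
  have ndvd x : ~~ (p%:Z %| x)%Z -> ~~ (p %| absz (k%:Z * x)%R)%N.
    by move=> ndx; rewrite abszM Euclid_dvdM // negb_or ndk.
  by case: ifP => _; apply: ndvd; rewrite // rpredDr ?dvdz_mull.
have normE : p%:Z ^+ 2 * (z ^+ 2 - p%:Z * z * y - y ^+ 2) =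
    (-1) ^+ s * p%:Z ^+ alpha * d ^+ 2.
  rewrite zyE /d -exprM -mulrA -exprD mulrCA -exprD; congr (_ * _ ^+ _).
  by lia.
suff E : \sum_l b l ^+ 2 = (k%:Z * y) ^+ 2 + (k%:Z * (y + z * p%:Z)) ^+ 2 +
      ((2 + p%:Z ^+ 2) * d) ^+ 2 /\
    \prod_l b l = (k%:Z * y) * (k%:Z * (y + z * p%:Z)) * ((2 + p%:Z ^+ 2) * d).
  case: E => -> ->; rewrite -/d.
  (* The conic in the two other coordinates is rewritten as [p ^ 2] times the norm form. *)
  transitivity (d * (k%:Z ^+ 2 * (p%:Z ^+ 2 * (z ^+ 2 - p%:Z * z * y - y ^+ 2)) +
     ((2 + p%:Z ^+ 2) * d) ^+ 2)); first by ring.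
  by rewrite normE mE; ring.
(* [ordS] is the cyclic successor, so each of the three positions of [i] gives a permutation of the
   same terms. *)
rewrite !big_ord_recl !big_ord0 /b.
by case: i {wi b} => [[|[|[|]]] //= lt_i]; split; ring.
Qed.

Theorem theorem4p2 (p : nat) (w : 'I_3 -> natbar) (m : int) (alpha k : nat)
  (p_prime : prime p) (p_gt2 : (2 < p)%N)
  (Cl_triv : Cl_trivial (p%:Z ^+ 2 + 4)%R)
  (w_ge2 : forall (l : 'I_3) (n : nat), w l = Some n -> (2 <= n)%N)
  (w_finite : exists (l : 'I_3) (n : nat), w l = Some n)
  (k_gt0 : (0 < k)%N) (p_ndvd_k : ~~ (p %| k)%N)
  (m_def : (m = (2 + p%:Z ^+ 2) ^+ 2 + p%:Z ^+ alpha * k%:Z ^+ 2)%R \/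
           (m = (2 + p%:Z ^+ 2) ^+ 2 - p%:Z ^+ alpha * k%:Z ^+ 2)%R)
  (m_neq0 : m <> 0%R) (m_neq4 : m <> 4%R) :
  (campana_str_points m w !=set0 /\ darmon_str_points m w !=set0)%classic.
Proof.
have [i [N wi]] := w_finite.
have [s mE] : exists s : bool,
    m = (2 + p%:Z ^+ 2) ^+ 2 + (-1) ^+ s * (p%:Z ^+ alpha * k%:Z ^+ 2).
  by case: m_def => ->; [exists false; rewrite mul1r | exists true; rewrite mulN1r].
split; apply: (orbifold_str_points_neq0 _ _ p_prime p_gt2 wi (w_ge2 _ _ wi)
                p_ndvd_k mE) => /=.
- by move=> n; right.
- by left.
- by move=> n; exists 0%N; rewrite muln0.
- by exists 1%N; rewrite muln1.
Qed.
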